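(* Let $R>0$, $\Omega=\{(x,y)\in\mathbb{R}^2 : x^2+y^2\le R^2\}$ and $f\in L^2(\Omega)$ (complex-valued). Let $M\ge 1$ be an integer, let $k_j=k_1+(j-1)\Delta k$ for $j=1,\dots,M$ be equally spaced real frequencies, let $K_c=(k_1+k_M)/2$, and let $\Theta=\{\theta_1,\dots,\theta_P\}$ be a finite set of angles. For $\theta\in\Theta$ write $\vec{\xi}_\theta=(\cos\theta,\sin\theta)$, and let the data be $$\hat f(k_j,\theta)=\iint_\Omega f(\mathbf{x}')\,e^{-ik_j\,\vec{\xi}_\theta\cdot \mathbf{x}'}\,dA(\mathbf{x}').$$ Define the matched filter reconstruction, for $\mathbf{x}=(x,y)$, by $$f_{MF}(x,y)=\sum_{\theta\in\Theta}\sum_{j=1}^M \hat f(k_j,\theta)\,e^{ik_j\,\vec{\xi}_\theta\cdot\mathbf{x}}.$$ Then $$f_{MF}(x,y)=\sum_{\theta\in\Theta}\bigl(p_\theta f * H(\cdot\,;K_c,M,\Delta k)\bigr)(\vec{\xi}_\theta\cdot\mathbf{x}).$$ Moreover, $f_{MF}$ is the convolution of $f$ with a kernel: $$f_{MF}(x,y)=\bigl(f*\mathcal{K}(\cdot\,;K_c,M,\Delta k,\Theta)\bigr)(x,y),\qquad \mathcal{K}(x,y;K_c,M,\Delta k,\Theta)=\sum_{\theta\in\Theta}H(\vec{\xi}_\theta\cdot\mathbf{x};K_c,M,\Delta k).$$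
   Context: Projection: for $w\in[-R,R]$, $p_\theta f(w)=\int_{-\sqrt{R^2-w^2}}^{\sqrt{R^2-w^2}} f\bigl((w,z)Q_\theta^{T}\bigr)\,dz$, where $Q_\theta=\begin{pmatrix}\cos\theta&-\sin\theta\\ \sin\theta&\cos\theta\end{pmatrix}$ and $(w,z)$ is a row vector. Kernel: $H(x;K_c,M,\Delta k)=e^{iK_cx}D_{\frac{M-1}{2}}(\Delta k\,x)$, where for a nonnegative integer or half-integer $n$ the Dirichlet kernel is $D_n(x)=\sum_{k\in\{-n,-n+1,\dots,n\}}e^{ikx}=\frac{\sin((n+1/2)x)}{\sin(x/2)}$ (the quotient being extended by continuity at $x\in 2\pi\mathbb{Z}$). Convolutions: $(p_\theta f*H)(t)=\int_{-R}^R p_\theta f(w)H(t-w)\,dw$ for $t\in\mathbb{R}$, and $(f*\mathcal{K})(\mathbf{x})=\iint_\Omega f(\mathbf{x}')\mathcal{K}(\mathbf{x}-\mathbf{x}')\,dA(\mathbf{x}')$ (no normalizing constants). *)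

(* Defs.v *)
From HB Require Import structures.
From mathcomp Require Import all_boot all_order all_algebra.
From mathcomp Require Import finmap.
From mathcomp Require Import all_classical all_reals all_analysis.
From mathcomp Require Import complex.

Set Implicit Arguments.
Unset Strict Implicit.
Unset Printing Implicit Defensive.

Import Order.TTheory GRing.Theory Num.Theory.
Import numFieldNormedType.Exports.

Local Open Scope classical_set_scope.
Local Open Scope complex_scope.
Local Open Scope ring_scope.

Section MatchedFilter.
Context {R : realType}.
Implicit Types (r t w k Kc dk theta : R) (p q : R * R) (M N : nat).

Definition lebesgue1 : {measure set (measurableTypeR R) -> \bar R} :=
  @lebesgue_measure R.

Definition lebesgue2 :
    {measure set (measurableTypeR R * measurableTypeR R) -> \bar R} :=
  (lebesgue1 \x lebesgue1)%E.

(* Total: [Rintegral] sends an infinite real or imaginary integral to 0 *)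
Definition cintegral d (T : measurableType d) (mu : {measure set T -> \bar R})
    (D : set T) (g : T -> R[i]) : R[i] :=
  Rintegral mu D (fun x => complex.Re (g x))
    +i* Rintegral mu D (fun x => complex.Im (g x)).

Definition cmeasurable d (T : measurableType d) (D : set T)
    (g : T -> R[i]) : Prop :=
  measurable_fun D (fun x => complex.Re (g x)) /\
  measurable_fun D (fun x => complex.Im (g x)).

(* [measurable_fun] is Borel measurability.  The function [f] is only required
   to represent a class of square integrable Borel functions modulo equality
   almost everywhere on [D], so [f] may be any Lebesgue measurable
   representative. *)
Definition sq_integrable d (T : measurableType d) (mu : {measure set T -> \bar R})
    (D : set T) (f : T -> R[i]) : Prop :=
  exists g : T -> R[i],
    [/\ cmeasurable D g,
        (\int[mu]_(x in D) ((ComplexField.Normc.normc (g x)) ^+ 2)%:E < +oo)%E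
      & {ae mu, forall x, D x -> f x = g x}].

(* e ^ (i t) *)
Definition expi t : R[i] := cos t +i* sin t.

Definition disk r : set (R * R) := [set p | p.1 ^+ 2 + p.2 ^+ 2 <= r ^+ 2].

Definition dot p q : R := p.1 * q.1 + p.2 * q.2.

Definition xi theta : R * R := (cos theta, sin theta).

Definition rotation theta : 'M[R]_2 :=
  \matrix_(i < 2, j < 2)
    (if i == j then cos theta else if (i < j)%N then - sin theta else sin theta).

(* The point (w, z) Q_theta^T, with (w, z) a row vector *)
Definition rotate theta p : R * R :=
  let v := (\row_(j < 2) (if j == 0 then p.1 else p.2)) *m (rotation theta)^T in
  (v 0 0, v 0 1).

Definition projection r (f : R * R -> R[i]) theta w : R[i] :=
  let a := Num.sqrt (r ^+ 2 - w ^+ 2) in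
  cintegral lebesgue1 `[- a, a] (fun z => f (rotate theta (w, z))).

(* [dirichlet N] is D_(N / 2): the order of the Dirichlet kernel, a nonnegative
   integer or half-integer, is represented by its double. *)
Definition dirichlet N t : R[i] :=
  \sum_(j < N.+1) expi ((- (N%:R / 2) + j%:R) * t).

Definition Hkernel Kc M dk t : R[i] := expi (Kc * t) * dirichlet M.-1 (dk * t).

Definition convolution1 r (g h : R -> R[i]) t : R[i] :=
  cintegral lebesgue1 `[- r, r] (fun w => g w * h (t - w)).

Definition convolution2 r (f K : R * R -> R[i]) p : R[i] :=
  cintegral lebesgue2 (disk r) (fun q => f q * K (p.1 - q.1, p.2 - q.2)).

Definition fourier_data r (f : R * R -> R[i]) k theta : R[i] :=
  cintegral lebesgue2 (disk r) (fun q => f q * expi (- k * dot (xi theta) q)).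

(* The frequencies are k 1, ..., k M; the other values of k are not used *)
Definition matched_filter r (f : R * R -> R[i]) M (k : nat -> R)
    (Theta : {fset R}) p : R[i] :=
  \sum_(theta <- Theta) \sum_(1 <= j < M.+1)
    fourier_data r f (k j) theta * expi (k j * dot (xi theta) p).

Definition MFkernel Kc M dk (Theta : {fset R}) p : R[i] :=
  \sum_(theta <- Theta) Hkernel Kc M dk (dot (xi theta) p).

End MatchedFilter.

(* Main.v *)
Require Import Defs.
From HB Require Import structures.
From mathcomp Require Import all_boot all_order all_algebra.
From mathcomp Require Import finmap.
From mathcomp Require Import all_classical all_reals all_analysis.
From mathcomp Require Import complex.
From mathcomp Require Import measurable_realfun.
From mathcomp Require Import ring lra.

Import Order.TTheory GRing.Theory Num.Theory.
Import numFieldNormedType.Exports.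
Local Open Scope ring_scope.

(* Summing the equally spaced frequencies gives
   \sum_j e^(i k_j t) = H(t), so by linearity the term of angle theta is
   \int_disk f(q) H(xi . x - xi . q) dq; summing over theta gives the kernel
   form.  Substituting q = rotate theta (w, z), for which xi . q = w, and
   applying Fubini turns that integral into the convolution of the projection
   of f with H.  Rotations preserve the planar Lebesgue measure because they
   are products of shears, which preserve it by translation invariance on
   sections.  Since f is only a.e. equal to a Borel function g, its projections
   need not be measurable; they agree with those of g for almost every w, and
   the integral depends only on the a.e. class of its integrand. *)

(** * Rotation invariance of the planar Lebesgue measure *)

Section rotation_invariance.
Set Implicit Arguments.
Unset Strict Implicit.
Unset Printing Implicit Defensive.
Local Open Scope classical_set_scope.
Context {R : realType}.
Local Notation mR := (measurableTypeR R).
Local Notation mu1 := (@lebesgue1 R).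
Local Notation mu2 := (@lebesgue2 R).

(** The pushforward by the translation gives half-open intervals their length, and this determines
    Lebesgue measure. *)
Lemma lebesgue1_translate (a : R) (A : set mR) : measurable A ->
  mu1 ((fun x : mR => x + a : mR) @^-1` A) = mu1 A.
Proof.
move=> mA; apply/esym.
have mt : measurable_fun [set: mR] (fun x : mR => x + a : mR).
  exact: measurable_funD.
apply: (@lebesgue_measure_unique R (pushforward mu1 _)) => //=.
move=> _ [[b c]] _ <-.
rewrite /pushforward (_ : _ @^-1` _ = `]b - a, c - a]%classic); last first.
  by apply/seteqP; split => x /=; rewrite !in_itv/= ltrBlDr lerBrDr.
rewrite /lebesgue1/= !lebesgue_measure_itv/= !lte_fin ltrD2r; case: ifP => // _.
by rewrite -!EFinD; congr (_%:E); rewrite opprB addrA subrK.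
Qed.

Definition measure_preserving (T : mR * mR -> mR * mR) :=
  measurable_fun setT T /\
  forall A, measurable A -> mu2 (T @^-1` A) = mu2 A.

Lemma measure_preserving_comp (S T : mR * mR -> mR * mR) :
  measure_preserving S -> measure_preserving T -> measure_preserving (S \o T).
Proof.
move=> [mS pS] [mT pT]; split; first exact: measurableT_comp.
move=> A mA; rewrite comp_preimage pT ?pS//.
by rewrite -[X in measurable X]setTI; exact: mS.
Qed.

Lemma shearl_measure_preserving (a : R) :
  measure_preserving (fun p : mR * mR => (p.1 + a * p.2, p.2) : mR * mR).
Proof.
have mT : measurable_fun [set: mR * mR]
    (fun p : mR * mR => (p.1 + a * p.2, p.2) : mR * mR).
  apply: measurable_fun_pair => //=;  apply: measurable_funD => //=.
  exact: measurable_funM.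
(* [mu2] integrates the measures of vertical sections, while this shear translates horizontal ones.
   Uniqueness of the product measure lets the sections be taken in the other order. *)
have eq12 A : measurable A -> mu2 A = (mu1 \x^ mu1)%E A.
  move=> mA; apply: product_measure_unique => // B C mB mC /=.
  by rewrite product_measure2E.
split=> // A mA; rewrite !eq12//; last first.
  by rewrite -[X in measurable X]setTI; exact: mT.
apply: eq_integral => y _ /=.
rewrite -[RHS](lebesgue1_translate (a * y)); last exact: measurable_ysection.
by congr (lebesgue_measure _); apply/seteqP; split => x /=;
  rewrite /ysection/= !inE.
Qed.

(** Here the translated sections are the vertical ones, which [mu2] integrates by definition. *)
Lemma shearr_measure_preserving (a : R) :
  measure_preserving (fun p : mR * mR => (p.1, p.2 + a * p.1) : mR * mR).
Proof.
have mT : measurable_fun [set: mR * mR]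
    (fun p : mR * mR => (p.1, p.2 + a * p.1) : mR * mR).
  apply: measurable_fun_pair => //=; apply: measurable_funD => //=.
  exact: measurable_funM.
split=> // A mA.
apply: eq_integral => y _ /=.
rewrite -[RHS](lebesgue1_translate (a * y)); last exact: measurable_xsection.
by congr (lebesgue_measure _); apply/seteqP; split => x /=;
  rewrite /xsection/= !inE.
Qed.

Lemma rotation_measure_preserving (c s : R) : c ^+ 2 + s ^+ 2 = 1 ->
  measure_preserving
    (fun p : mR * mR => (p.1 * c - p.2 * s, p.1 * s + p.2 * c) : mR * mR).
Proof.
have shear (b t : R) : b ^+ 2 + t ^+ 2 = 1 -> 1 + b != 0 -> measure_preserving
    (fun p : mR * mR => (p.1 * b - p.2 * t, p.1 * t + p.2 * b) : mR * mR).
  (* For b = cos u and t = sin u, the shear coefficient a is - tan (u / 2). *)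
  move=> bt b1; pose a := - (t / (1 + b)).
  have := measure_preserving_comp (shearl_measure_preserving a)
    (measure_preserving_comp (shearr_measure_preserving t)
      (shearl_measure_preserving a)).
  set S := (X in measure_preserving X).
  set S' := (X in _ -> measure_preserving X).
  suff -> : S = S' by [].
  (* The product of the three shears has both diagonal entries [1 + a * t] and upper right entry
     [a * (2 + a * t)]; the next identities turn these into [b] and [- t]. *)
  have tE : t ^+ 2 = (1 + b) * (1 - b).
    by apply: (addrI (b ^+ 2)); rewrite bt; ring.
  have abt : a * (1 + b) = - t by rewrite /a mulNr divfK.
  have at1 : 1 + a * t = b.
    rewrite /a mulNr mulrAC -expr2 tE mulrAC divff// mul1r; ring.
  apply/funext => -[x y]; rewrite /S /S' /=; congr (_, _).
    transitivity (x * (1 + a * t) + y * (a * (1 + (1 + a * t)))); first by ring.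
    by rewrite at1 abt mulrN.
  transitivity (x * t + y * (1 + a * t)); first by ring.
  by rewrite at1.
(* The half-turn is the square of a quarter-turn. *)
move=> cs; have [c1|] := eqVneq (1 + c) 0; last exact: shear.
have cE : c = -1 by apply/eqP; rewrite -subr_eq0 opprK addrC c1.
have sE : s = 0.
  apply/eqP; rewrite -sqrf_eq0; apply/eqP/(addrI (c ^+ 2)).
  by rewrite cs cE sqrrN expr1n addr0.
have q : measure_preserving (fun p : mR * mR =>
    (p.1 * 0 - p.2 * 1, p.1 * 1 + p.2 * 0) : mR * mR).
  by apply: shear; rewrite ?expr0n/= ?expr1n ?add0r ?addr0 ?oner_eq0.
have := measure_preserving_comp q q.
set S := (X in measure_preserving X).
set S' := (X in _ -> measure_preserving X).
suff -> : S = S' by [].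
by apply/funext => -[x y]; rewrite /S /S' /= cE sE; congr (_, _); ring.
Qed.
End rotation_invariance.

(** * Complex integrals: almost everywhere equality, linearity, integrability *)

Section cintegral.
Set Implicit Arguments.
Unset Strict Implicit.
Unset Printing Implicit Defensive.
Local Open Scope classical_set_scope.
Context d (T : measurableType d) (R : realType).
Variable mu : {measure set T -> \bar R}.
Import HBNNSimple.

(** The integral of a nonnegative function is a supremum over simple functions below it, whether or
    not it is measurable. A simple function below [f], set to 0 on a null set containing the
    exceptional points, lies below [g] and keeps its integral. *)
Lemma ge0_ae_le_integral (f g : T -> \bar R) :
  (forall x, 0 <= f x)%E -> (forall x, 0 <= g x)%E ->
  {ae mu, forall x, f x = g x} -> (\int[mu]_x f x <= \int[mu]_x g x)%E.
Proof.
move=> f0 g0 [N [mN N0 fgN]]; rewrite !ge0_integralTE//.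
apply: ge_ereal_sup => _ [h hf <-].
have mCN : measurable (~` N) by exact: measurableC.
apply: ereal_sup_ubound; exists (proj_nnsfun h mCN).
  move=> x /=; rewrite /= mindicE; have [xN|xN] := boolP (x \in ~` N).
    rewrite mulr1 -(_ : f x = g x)//; apply: contrapT => fgx.
    by move: xN; rewrite inE; apply; exact: fgN.
  by rewrite mulr0.
rewrite -!integralT_nnsfun; apply: ae_eq_integral => //.
- exact/measurable_EFinP.
- exact/measurable_EFinP.
exists N; split=> // x /= hx; apply: contrapT => Nx; apply: hx => _.
by rewrite mindicE mem_set//= mulr1.
Qed.

(** Two opposite inequalities for the positive part and two for the negative part. No measurability
    is assumed, so this applies to any representative [f] and to its sections. *)
Lemma ae_eq_integral_nonmeasurable (D : set T) (f g : T -> \bar R) :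
  {ae mu, forall x, D x -> f x = g x} ->
  (\int[mu]_(x in D) f x = \int[mu]_(x in D) g x)%E.
Proof.
move=> fg.
have {}fg : {ae mu, forall x, (f \_ D) x = (g \_ D) x}.
  apply: filterS fg => x fgx; rewrite /patch; case: ifPn => //.
  by rewrite inE.
rewrite integral_mkcond [RHS]integral_mkcond integralE [RHS]integralE.
by congr (_ - _)%E; apply/eqP; rewrite eq_le; apply/andP; split;
  apply: ge0_ae_le_integral => //; apply: filterS fg => x fgx;
  rewrite ?funeposE ?funenegE fgx.
Qed.

Lemma ae_eq_cintegral (D : set T) (f g : T -> R[i]) :
  {ae mu, forall x, D x -> f x = g x} ->
  cintegral mu D f = cintegral mu D g.
Proof.
move=> fg; rewrite /cintegral /Rintegral; congr (fine _ +i* fine _)%C;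
  by apply: ae_eq_integral_nonmeasurable; apply: filterS fg => x fgx Dx;
     rewrite fgx.
Qed.

Lemma eq_cintegral (D : set T) (f g : T -> R[i]) :
  (forall x, D x -> f x = g x) -> cintegral mu D f = cintegral mu D g.
Proof. by move=> fg; apply: ae_eq_cintegral; exact: aeW. Qed.

Lemma ae_eq_cintegralM (D : set T) (f g h : T -> R[i]) :
  {ae mu, forall x, D x -> f x = g x} ->
  cintegral mu D (fun x => f x * h x) = cintegral mu D (fun x => g x * h x).
Proof.
move=> fg; apply: ae_eq_cintegral.
by apply: filterS fg => x fgx Dx; rewrite fgx.
Qed.

Definition cintegrable (D : set T) (f : T -> R[i]) : Prop :=
  mu.-integrable D (fun x => (complex.Re (f x))%:E) /\
  mu.-integrable D (fun x => (complex.Im (f x))%:E).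

Lemma eq_cintegrable (D : set T) (f g : T -> R[i]) : measurable D ->
  (forall x, D x -> f x = g x) -> cintegrable D f -> cintegrable D g.
Proof.
move=> mD fg [rf jf]; split.
  by move: rf; apply: eq_integrable => // x; rewrite inE => Dx; rewrite fg.
by move: jf; apply: eq_integrable => // x; rewrite inE => Dx; rewrite fg.
Qed.

(** Extension by zero, which moves integrals to the whole space, where Fubini and the change of
    variables are stated. *)
Definition crestrict (D : set T) (f : T -> R[i]) (x : T) : R[i] :=
  if x \in D then f x else 0.

Lemma cintegral_crestrict (D : set T) (f : T -> R[i]) :
  cintegral mu setT (crestrict D f) = cintegral mu D f.
Proof.
rewrite /cintegral; congr (_ +i* _)%C; rewrite [RHS]Rintegral_mkcond;
  by congr (Rintegral _ _ _); apply/funext => x; rewrite /patch /crestrict;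
     case: ifP.
Qed.

Lemma cintegrable_crestrict (D : set T) (f : T -> R[i]) : measurable D ->
  cintegrable D f -> cintegrable setT (crestrict D f).
Proof.
move=> mD [rf jf]; split.
  move/(integrable_mkcond _ mD): rf; apply: eq_integrable => // x _.
  by rewrite /patch /crestrict; case: ifP.
move/(integrable_mkcond _ mD): jf; apply: eq_integrable => // x _.
by rewrite /patch /crestrict; case: ifP.
Qed.

Lemma cintegral0 (D : set T) : cintegral mu D (fun=> 0) = 0.
Proof.
rewrite /cintegral /Rintegral/= [X in fine X](_ : _ = 0%E)//.
exact: integral0.
Qed.

Lemma cintegrable0 (D : set T) : measurable D -> cintegrable D (fun=> 0).
Proof. by move=> mD; split; exact: integrable0. Qed.

Lemma cintegrableD (D : set T) (f g : T -> R[i]) : measurable D ->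
  cintegrable D f -> cintegrable D g -> cintegrable D (fun x => f x + g x).
Proof.
move=> mD [rf jf] [rg jg]; split.
  have := integrableD mD rf rg; apply: eq_integrable => // x _.
  by rewrite raddfD.
have := integrableD mD jf jg; apply: eq_integrable => // x _.
by rewrite raddfD.
Qed.

Lemma cintegralD (D : set T) (f g : T -> R[i]) : measurable D ->
  cintegrable D f -> cintegrable D g ->
  cintegral mu D (fun x => f x + g x) = cintegral mu D f + cintegral mu D g.
Proof.
move=> mD [rf jf] [rg jg]; rewrite /cintegral.
under [in LHS]eq_Rintegral do rewrite raddfD.
under [X in (_ +i* X)%C = _]eq_Rintegral do rewrite raddfD.
by rewrite !RintegralD.
Qed.

Lemma cintegrable_sum (I : Type) (s : seq I) (D : set T) (f : I -> T -> R[i]) :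
  measurable D -> (forall i, cintegrable D (f i)) ->
  cintegrable D (fun x => \sum_(i <- s) f i x).
Proof.
move=> mD fi; elim: s => [|i s IH].
  apply: (eq_cintegrable mD _ (cintegrable0 mD)) => x _.
  by rewrite big_nil.
apply: (eq_cintegrable mD _ (cintegrableD mD (fi i) IH)) => x _.
by rewrite big_cons.
Qed.

Lemma cintegral_sum (I : Type) (s : seq I) (D : set T) (f : I -> T -> R[i]) :
  measurable D -> (forall i, cintegrable D (f i)) ->
  cintegral mu D (fun x => \sum_(i <- s) f i x) =
  \sum_(i <- s) cintegral mu D (f i).
Proof.
move=> mD fi; elim: s => [|i s IH].
  by rewrite big_nil; under eq_cintegral do rewrite big_nil; exact: cintegral0.
rewrite big_cons -IH -cintegralD//; last exact: cintegrable_sum.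
by apply: eq_cintegral => x _; rewrite big_cons.
Qed.

Definition cbounded (g : T -> R[i]) : Prop :=
  exists M : R, forall x, `|complex.Re (g x)| <= M /\ `|complex.Im (g x)| <= M.

(** The real and imaginary parts of the product are sums or differences of terms, each an integrable
    function times a bounded measurable one. *)
Lemma cintegrableM (D : set T) (f h : T -> R[i]) : measurable D ->
  cintegrable D f -> cmeasurable D h -> cbounded h ->
  cintegrable D (fun x => f x * h x).
Proof.
move=> mD [rf jf] [mr mi] [M hM].
have bR : [bounded complex.Re (h x) | x in D].
  exists M; split; first exact: num_real.
  by move=> y My x _ /=; rewrite (le_trans (hM x).1)// ltW.
have bI : [bounded complex.Im (h x) | x in D].
  exists M; split; first exact: num_real.
  by move=> y My x _ /=; rewrite (le_trans (hM x).2)// ltW.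
split.
  have := integrableB mD (integrableMl mD rf mr bR) (integrableMl mD jf mi bI).
  by apply: eq_integrable => // x _ /=; case: (f x) (h x) => [a b] [a' b'].
have := integrableD mD (integrableMl mD rf mi bI) (integrableMl mD jf mr bR).
by apply: eq_integrable => // x _ /=; case: (f x) (h x) => [a b] [a' b'].
Qed.

Lemma cintegralZr (D : set T) (f : T -> R[i]) (c : R[i]) : measurable D ->
  cintegrable D f -> cintegral mu D (fun x => f x * c) = cintegral mu D f * c.
Proof.
move=> mD [rf jf]; case: c => a b; rewrite /cintegral.
rewrite (@eq_Rintegral _ _ _ _ _
    (fun x => complex.Re (f x) * a - complex.Im (f x) * b));
  last by move=> x _; case: (f x).
rewrite [X in (_ +i* X)%C = _](@eq_Rintegral _ _ _ _ _
    (fun x => complex.Re (f x) * b + complex.Im (f x) * a));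
  last by move=> x _; case: (f x).
have rZ c : mu.-integrable D (fun x => (complex.Re (f x) * c)%:E).
  by have := integrableZr mD c rf; exact: eq_integrable.
have jZ c : mu.-integrable D (fun x => (complex.Im (f x) * c)%:E).
  by have := integrableZr mD c jf; exact: eq_integrable.
rewrite (RintegralB mD (rZ a) (jZ b)) (RintegralD mD (rZ b) (jZ a)).
by rewrite !RintegralZr.
Qed.

End cintegral.

(** * Change of variables and Fubini in the plane *)

Section plane.
Set Implicit Arguments.
Unset Strict Implicit.
Unset Printing Implicit Defensive.
Local Open Scope classical_set_scope.
Context {R : realType}.
Local Notation mR := (measurableTypeR R).
Local Notation mu1 := (@lebesgue1 R).
Local Notation mu2 := (@lebesgue2 R).

Section change_of_variables.
Variable T : mR * mR -> mR * mR.
Hypothesis pT : measure_preserving T.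
Let mT : measurable_fun setT T := pT.1.

Lemma measure_preserving_ae (P : mR * mR -> Prop) :
  {ae mu2, forall p, P p} -> {ae mu2, forall p, P (T p)}.
Proof.
move=> [N [mN N0 PN]]; exists (T @^-1` N); split.
- by rewrite -[X in measurable X]setTI; exact: mT.
- by rewrite -N0; exact: pT.2.
- by move=> p /= Pp; exact: PN.
Qed.

(** The pushforward formula for signed functions asks for integrability of the composite. This is
    obtained first, from the nonnegative formula applied to the absolute value. *)
Lemma measure_preserving_integrable (f : mR * mR -> \bar R) :
  mu2.-integrable setT f -> mu2.-integrable setT (f \o T).
Proof.
move=> /integrableP[mf fi]; apply/integrableP; split.
  exact: measurableT_comp.
rewrite (_ : (\int[_]_(_ in _) _)%E = (\int[mu2]_x `|f x|)%E)//.
transitivity (\int[pushforward mu2 T]_x `|f x|)%E.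
  rewrite (ge0_integral_pushforward mT)//; exact: measurableT_comp.
by apply: eq_measure_integral => A mA _; exact: pT.2.
Qed.

Lemma measure_preserving_integral (f : mR * mR -> \bar R) :
  mu2.-integrable setT f ->
  (\int[mu2]_x f (T x) = \int[mu2]_x f x)%E.
Proof.
move=> fi; transitivity (\int[pushforward mu2 T]_x f x)%E.
  rewrite (integral_pushforward mT)//; first exact: measurable_int fi.
  exact: measure_preserving_integrable.
by apply: eq_measure_integral => A mA _; exact: pT.2.
Qed.

Lemma measure_preserving_cintegrable (f : mR * mR -> R[i]) :
  cintegrable mu2 setT f -> cintegrable mu2 setT (f \o T).
Proof.
move=> [rf jf]; split; first exact: (measure_preserving_integrable rf).
exact: (measure_preserving_integrable jf).
Qed.

Lemma measure_preserving_cintegral (f : mR * mR -> R[i]) :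
  cintegrable mu2 setT f ->
  cintegral mu2 setT (f \o T) = cintegral mu2 setT f.
Proof.
move=> [rf jf]; rewrite /cintegral /Rintegral; congr (fine _ +i* fine _)%C.
  exact: (measure_preserving_integral rf).
exact: (measure_preserving_integral jf).
Qed.

End change_of_variables.

(** The measures of the sections of a null set are nonnegative and integrate to 0, so almost all of
    them vanish. *)
Lemma ae_section (P : mR * mR -> Prop) : {ae mu2, forall p, P p} ->
  {ae mu1, forall w, {ae mu1, forall z, P (w, z)}}.
Proof.
move=> [N [mN N0 PN]].
have /ae_eq_integral_abs : measurable_fun [set: mR] (mu1 \o xsection N).
  exact: measurable_fun_xsection.
move=> /(_ mu1 measurableT)[+ _].
under eq_integral do rewrite gee0_abs//.
move=> /(_ N0); apply: filterS => w /= /(_ I) Nw.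
exists (xsection N w); split=> //; first exact: measurable_xsection.
by move=> z /= Pz; rewrite /xsection/= inE; exact: PN.
Qed.

(** [Rintegral] sends an infinite inner integral to 0, but almost every section is integrable, so
    this changes the outer integrand on a null set only. *)
Lemma Rintegral_Fubini (f : mR * mR -> R) : mu2.-integrable setT (EFin \o f) ->
  (\int[mu2]_p f p = \int[mu1]_w \int[mu1]_z f (w, z))%R.
Proof.
move=> fi; rewrite {1}/Rintegral -integral12_prod_meas1//; congr fine.
apply: ae_eq_integral_nonmeasurable; have := ae_integrable1 fi.
apply: filterS => w fw _; rewrite /fubini_F fineK//.
exact: (integrable_fin_num _ fw).
Qed.

Lemma cintegral_Fubini (f : mR * mR -> R[i]) : cintegrable mu2 setT f ->
  cintegral mu2 setT f =
  cintegral mu1 setT (fun w => cintegral mu1 setT (fun z => f (w, z))).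
Proof.
move=> [rf jf].
by rewrite {1}/cintegral (Rintegral_Fubini rf) (Rintegral_Fubini jf).
Qed.

Lemma ae_cintegrable_section (f : mR * mR -> R[i]) : cintegrable mu2 setT f ->
  {ae mu1, forall w, cintegrable mu1 setT (fun z => f (w, z))}.
Proof.
move=> [rf jf].
by apply: filterS2 (ae_integrable1 rf) (ae_integrable1 jf) => w rw jw; split.
Qed.

End plane.

(** * The disk, the projection formula and the sum over frequencies *)

Section matched_filter.
Set Implicit Arguments.
Unset Strict Implicit.
Unset Printing Implicit Defensive.
Local Open Scope classical_set_scope.
Context {R : realType}.
Local Notation mR := (measurableTypeR R).
Local Notation mu1 := (@lebesgue1 R).
Local Notation mu2 := (@lebesgue2 R).

(** On a set of finite measure [1 + a ^+ 2 + b ^+ 2] is integrable, and it dominates both [|a|] and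
    [|b|], where [a] and [b] are the real and imaginary parts. *)
Lemma sq_integrable_ae_cintegrable d (T : measurableType d)
    (mu : {measure set T -> \bar R}) (D : set T) (f : T -> R[i]) :
  measurable D -> (mu D < +oo)%E -> sq_integrable mu D f ->
  exists2 g, cintegrable mu D g & {ae mu, forall x, D x -> f x = g x}.
Proof.
move=> mD muD [g [[mr mi] gfin fg]]; exists g => //.
pose n2 x := complex.Re (g x) ^+ 2 + complex.Im (g x) ^+ 2.
have n2_ge0 x : 0 <= n2 x by rewrite addr_ge0 ?sqr_ge0.
have mn2 : measurable_fun D n2.
  by apply: measurable_funD; exact: measurable_funX.
have n2E x : ComplexField.Normc.normc (g x) ^+ 2 = n2 x.
  by rewrite /n2; case: (g x) => a b /=; rewrite sqr_sqrtr// addr_ge0 ?sqr_ge0.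
have in2 : mu.-integrable D (EFin \o n2).
  apply/integrableP; split; first exact/measurable_EFinP.
  apply: le_lt_trans gfin; rewrite le_eqVlt; apply/orP; left; apply/eqP.
  by apply: eq_integral => x _ /=; rewrite n2E ger0_norm.
have i1 : mu.-integrable D (EFin \o (cst 1 : T -> R)).
  apply: measurable_bounded_integrable => //.
  exists 1; split; first exact: num_real.
  by move=> y y1 x _ /=; rewrite normr1 ltW.
have i1n2 := integrableD mD i1 in2.
have le1D (a b : R) : `|a| <= 1 + (a ^+ 2 + b ^+ 2).
  have [a1|/ltW a1] := leP `|a| 1.
    by rewrite (le_trans a1)// lerDl addr_ge0 ?sqr_ge0.
  have a2 : `|a| <= a ^+ 2 by rewrite -real_normK ?num_real// expr2 ler_peMr.
  by rewrite (le_trans a2)// addrCA lerDl addr_ge0 ?ler01 ?sqr_ge0.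
split; apply: le_integrable i1n2 => //; try exact/measurable_EFinP;
  move=> x _ /=;
  rewrite lee_fin [leRHS]ger0_norm ?(addr_ge0 ler01 (n2_ge0 x))//.
  exact: le1D.
by rewrite /n2 [X in 1 + X]addrC; exact: le1D.
Qed.

Lemma measurable_disk (r : R) : measurable (disk r : set (mR * mR)).
Proof.
have mf : measurable_fun [set: mR * mR]
    (fun p : mR * mR => p.1 ^+ 2 + p.2 ^+ 2 : mR).
  by apply: measurable_funD; exact: measurable_funX.
have := mf measurableT `]-oo, (r ^+ 2)]%classic (measurable_itv _).
by rewrite setTI.
Qed.

(** The disk lies in a square of side [2 * |r|]. *)
Lemma disk_lty (r : R) : (mu2 (disk r) < +oo)%E.
Proof.
pose I : set mR := `[- `|r|, `|r|]%classic.
have mI : measurable I by exact: measurable_itv.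
have muI : (mu1 I < +oo)%E.
  by rewrite /lebesgue1/= lebesgue_measure_itv/=; case: ifP => _;
     rewrite -?EFinD ltry.
apply: (@le_lt_trans _ _ (mu2 (I `*` I))); last first.
  by rewrite /lebesgue2/= product_measure1E// lte_mul_pinfty// ge0_fin_numE.
apply: le_measure; rewrite ?inE//.
- exact: measurable_disk.
- exact: measurableX.
have le_r (a b : R) : a ^+ 2 + b ^+ 2 <= r ^+ 2 -> `|a| <= `|r|.
  move=> ab; rewrite -!sqrtr_sqr ler_sqrt ?sqr_ge0//.
  by rewrite (le_trans _ ab)// lerDl sqr_ge0.
move=> [x y]; rewrite /disk/= => xy; split; rewrite /I/= in_itv/= -ler_norml.
  exact: le_r xy.
by apply: le_r; rewrite addrC; exact: xy.
Qed.

Lemma rotateE (theta : R) (p : R * R) :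
  rotate theta p = (p.1 * cos theta - p.2 * sin theta,
                    p.1 * sin theta + p.2 * cos theta).
Proof.
rewrite /rotate !mxE !big_ord_recl !big_ord0 !mxE /= !addr0.
by rewrite mulrN.
Qed.

Lemma rotate_measure_preserving (theta : R) :
  measure_preserving (rotate theta : mR * mR -> mR * mR).
Proof.
have := rotation_measure_preserving (cos2Dsin2 theta).
by congr measure_preserving; apply/funext => p; rewrite rotateE.
Qed.

(** In rotated coordinates the kernel thus depends on [w] alone and can leave the inner integral
    over [z]. *)
Lemma dot_xi_rotate (theta : R) (p : R * R) :
  dot (xi theta) (rotate theta p) = p.1.
Proof.
rewrite rotateE /dot /xi/= -[RHS]mulr1 -(cos2Dsin2 theta); ring.
Qed.

Lemma disk_rotate (r theta : R) (p : R * R) :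
  disk r (rotate theta p) <-> disk r p.
Proof.
rewrite rotateE /disk/=.
suff -> : (p.1 * cos theta - p.2 * sin theta) ^+ 2 +
    (p.1 * sin theta + p.2 * cos theta) ^+ 2 = p.1 ^+ 2 + p.2 ^+ 2 by [].
rewrite -[RHS]mulr1 -(cos2Dsin2 theta); ring.
Qed.

(** For [w] outside [[- r, r]] the radicand is negative and [Num.sqrt] returns 0, so the second
    interval is the point 0 and not empty. The condition on [w] is therefore stated separately. *)
Lemma disk_section (r w z : R) : 0 <= r ->
  disk r (w, z) <-> w \in `[- r, r]%classic /\
    z \in `[- Num.sqrt (r ^+ 2 - w ^+ 2), Num.sqrt (r ^+ 2 - w ^+ 2)]%classic.
Proof.
move=> r0; rewrite /disk/= !inE/= !in_itv/= -!ler_norml -!sqrtr_sqr.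
rewrite -[X in _ <= X /\ _](ger0_norm r0) -sqrtr_sqr ler_sqrt ?sqr_ge0//.
split=> [wz|[wr]].
  have wr : w ^+ 2 <= r ^+ 2 by rewrite (le_trans _ wz)// lerDl sqr_ge0.
  by split => //; rewrite ler_sqrt ?subr_ge0// lerBrDl.
by rewrite ler_sqrt ?subr_ge0// lerBrDl.
Qed.

(** Integrability of the product with [h] justifies Fubini; that of [g] makes almost every rotated
    section integrable, so that [h (t - w)] can be taken out of the inner integral. *)
Lemma convolution1_projection (r : R) (f g : R * R -> R[i]) (theta : R)
    (h : R -> R[i]) (t : R) : 0 <= r ->
  cintegrable mu2 (disk r) g ->
  {ae mu2, forall q, disk r q -> f q = g q} ->
  cintegrable mu2 (disk r) (fun q => g q * h (t - dot (xi theta) q)) ->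
  convolution1 r (projection r f theta) h t =
  cintegral mu2 (disk r) (fun q => f q * h (t - dot (xi theta) q)).
Proof.
move=> r0 ig fg igh.
have mD := measurable_disk r.
have pT := rotate_measure_preserving theta.
have iG := measure_preserving_cintegrable pT (cintegrable_crestrict mD ig).
have iF := cintegrable_crestrict mD igh.
rewrite (ae_eq_cintegralM _ fg).
rewrite -[RHS]cintegral_crestrict -[RHS](measure_preserving_cintegral pT)//.
rewrite cintegral_Fubini; last exact: measure_preserving_cintegrable.
rewrite /convolution1 -cintegral_crestrict; apply: ae_eq_cintegral.
(* For almost every [w], the rotated section of [g] is integrable and agrees with that of [f] at
   almost every [z] for which the rotated point is in the disk. *)
apply: filterS2 (ae_cintegrable_section iG)
  (ae_section (measure_preserving_ae pT fg)).
move=> w iGw fgw _.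
transitivity (cintegral mu1 setT (fun z =>
    (crestrict (disk r) g \o rotate theta) (w, z) * h (t - w))); last first.
  apply: eq_cintegral => z _; rewrite /crestrict/=; case: ifP; rewrite ?mul0r//.
  by rewrite dot_xi_rotate.
(* For [w] in [[- r, r]] the section of the disk is the integration interval of the projection;
   otherwise the section is empty and both sides are 0. *)
rewrite cintegralZr// /crestrict; have [wr|wr] := boolP (w \in _).
  congr (_ * _); rewrite /projection -cintegral_crestrict.
  apply: ae_eq_cintegral.
  apply: filterS fgw => z fgz _; rewrite /crestrict/=.
  have wz := disk_section w z r0.
  have wz' := disk_rotate r theta (w, z).
  case: ifPn => [|/negP] hz; case: ifPn => [|/negP] hz'//.
  - by apply: fgz; move: hz'; rewrite inE.
  - by case: hz'; rewrite inE; apply/wz'/wz.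
  - by case: hz; move: hz'; rewrite inE => /wz'/wz[].
rewrite [X in _ = X * _](_ : _ = 0) ?mul0r// -[RHS](cintegral0 mu1 setT).
apply: eq_cintegral => z _ /=; case: ifPn => //; rewrite inE.
by move/disk_rotate/(disk_section _ _ r0) => [wr' _]; rewrite wr' in wr.
Qed.

Lemma expiD (a b : R) : expi (a + b) = expi a * expi b.
Proof.
by rewrite /expi cosD sinD; congr (_ +i* _)%C; rewrite addrC (mulrC (cos _)).
Qed.

Lemma expi_bounded d (T : measurableType d) (u : T -> R) :
  cbounded (fun x => expi (u x)).
Proof.
exists 1 => x; rewrite /expi/=.
by split; rewrite ler_norml ?cos_geN1 ?cos_le1 ?sin_geN1 ?sin_le1.
Qed.

Lemma expi_cmeasurable d (T : measurableType d) (D : set T) (u : T -> R) :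
  measurable_fun D u -> cmeasurable D (fun x => expi (u x)).
Proof.
move=> mu; split => /=.
  apply: (measurableT_comp _ mu); apply: continuous_measurable_fun.
  exact: continuous_cos.
apply: (measurableT_comp _ mu); apply: continuous_measurable_fun.
exact: continuous_sin.
Qed.

(** The frequency of index [i.+1] is [Kc + (- ((M - 1) / 2) + i) * dk] with [Kc] the midpoint, so
    [expi (Kc * t)] factors out and leaves the Dirichlet kernel. Since [1 <= M], its [M.-1.+1] terms
    are exactly [M] terms. *)
Lemma sum_expi_Hkernel (M : nat) (k : nat -> R) (dk t : R) : (1 <= M)%N ->
  (forall j : nat, (1 <= j <= M)%N -> k j = k 1%N + (j%:R - 1) * dk) ->
  \sum_(1 <= j < M.+1) expi (k j * t) =
  Hkernel ((k 1%N + k M) / 2) M dk t.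
Proof.
move=> M1 hk; rewrite big_add1/= big_mkord /Hkernel /dirichlet prednK//.
rewrite mulr_sumr; apply: eq_bigr => i _; rewrite -expiD; congr expi.
rewrite (hk i.+1) ?ltn_ord// (hk M) ?M1 ?leqnn//.
rewrite -[in M%:R](prednK M1) -!natr1; by field.
Qed.

Lemma cintegrable_mul_expi (r : R) (g : R * R -> R[i]) (u : R * R -> R) :
  cintegrable mu2 (disk r) g -> measurable_fun (disk r : set (mR * mR)) u ->
  cintegrable mu2 (disk r) (fun q => g q * expi (u q)).
Proof.
move=> ig mu; apply: cintegrableM => //.
- exact: measurable_disk.
- exact: expi_cmeasurable.
- exact: expi_bounded.
Qed.

Lemma measurable_dot (p : R * R) (D : set (mR * mR)) :
  measurable_fun D (dot p : mR * mR -> R).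
Proof.
apply: measurable_funTS; apply: measurable_funD => //=;
  exact: measurable_funM.
Qed.

(** The kernel expands into a finite sum of exponentials [expi], each bounded and measurable. *)
Lemma cintegrable_mul_Hkernel (r : R) (g : R * R -> R[i]) Kc M dk theta t :
  cintegrable mu2 (disk r) g -> cintegrable mu2 (disk r)
    (fun q => g q * Hkernel Kc M dk (t - dot (xi theta) q)).
Proof.
move=> ig; have mD := measurable_disk r.
pose F (j : 'I_M.-1.+1) q := g q *
  expi ((Kc + (- (M.-1%:R / 2) + j%:R) * dk) * (t - dot (xi theta) q)).
suff : cintegrable mu2 (disk r)
    (fun q => \sum_(j <- index_enum 'I_M.-1.+1) F j q).
  apply: eq_cintegrable => // q _.
  rewrite /F -mulr_sumr; congr (_ * _); rewrite /Hkernel /dirichlet mulr_sumr.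
  by apply: eq_bigr => j _; rewrite -expiD; congr expi; ring.
apply: cintegrable_sum => // j; apply: cintegrable_mul_expi => //.
apply: measurable_funM => //; apply: measurable_funB => //.
exact: measurable_dot.
Qed.

(** The phases at [p] and [q] multiply to [expi] of [k j] times the difference of the dot products.
    The sum and the integral are exchanged for [g], which is integrable, and [f] is replaced by [g]
    on both sides. *)
Lemma fourier_data_sumE (r : R) (f g : R * R -> R[i]) M (k : nat -> R)
    dk theta p :
  (1 <= M)%N ->
  (forall j : nat, (1 <= j <= M)%N -> k j = k 1%N + (j%:R - 1) * dk) ->
  cintegrable mu2 (disk r) g ->
  {ae mu2, forall q, disk r q -> f q = g q} ->
  \sum_(1 <= j < M.+1)
    fourier_data r f (k j) theta * expi (k j * dot (xi theta) p) =
  cintegral mu2 (disk r) (fun q => f q *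
    Hkernel ((k 1%N + k M) / 2) M dk (dot (xi theta) p - dot (xi theta) q)).
Proof.
move=> M1 hk ig fg; have mD := measurable_disk r.
have mE a : measurable_fun (disk r : set (mR * mR))
    (fun q => - a * dot (xi theta) q).
  by apply: measurable_funM => //; exact: measurable_dot.
have ie a := cintegrable_mul_expi ig (mE a).
transitivity (\sum_(1 <= j < M.+1) cintegral mu2 (disk r) (fun q =>
    g q * expi (- k j * dot (xi theta) q) * expi (k j * dot (xi theta) p))).
  apply: eq_bigr => j _; rewrite cintegralZr//; congr (_ * _).
  exact: ae_eq_cintegralM.
rewrite (ae_eq_cintegralM _ fg) -cintegral_sum//; last first.
  move=> j; apply: cintegrableM => //.
  exact: (expi_bounded (fun=> k j * dot (xi theta) p)).
apply: eq_cintegral => q _; rewrite -(sum_expi_Hkernel _ M1 hk) mulr_sumr.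
apply: eq_bigr => j _.
by rewrite -mulrA -expiD; congr (_ * expi _); ring.
Qed.

End matched_filter.

Theorem theorem1 (R : realType) (r : R) (f : R * R -> R[i]) (M : nat)
    (k : nat -> R) (dk : R) (Theta : {fset R})
    (hr : 0 < r)
    (hf : sq_integrable (@lebesgue2 R) (disk r) f)
    (hM : (1 <= M)%N)
    (hk : forall j : nat, (1 <= j <= M)%N -> k j = k 1%N + (j%:R - 1) * dk) :
  let Kc := (k 1%N + k M) / 2 in
  (forall x y : R,
     matched_filter r f M k Theta (x, y)
     = \sum_(theta <- Theta)
         convolution1 r (projection r f theta) (Hkernel Kc M dk) (dot (xi theta) (x, y)))
  /\
  (forall x y : R,
     matched_filter r f M k Theta (x, y)
     = convolution2 r f (MFkernel Kc M dk Theta) (x, y)).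
Proof.
move=> Kc.
have mD := measurable_disk r.
have [g ig fg] := sq_integrable_ae_cintegrable mD (disk_lty r) hf.
have igH theta t := cintegrable_mul_Hkernel Kc M dk theta t ig.
(* Both claims start from this common form, with one disk integral per angle. *)
have mfE p : matched_filter r f M k Theta p = \sum_(theta <- Theta)
    cintegral (@lebesgue2 R) (disk r) (fun q => f q *
      Hkernel Kc M dk (dot (xi theta) p - dot (xi theta) q)).
  by apply: eq_bigr => theta _; exact: fourier_data_sumE hM hk ig fg.
split=> x y; rewrite mfE.
  apply: eq_bigr => theta _.
  by rewrite (convolution1_projection (ltW hr) ig fg).
under eq_bigr do rewrite (ae_eq_cintegralM _ fg).
rewrite /convolution2 (ae_eq_cintegralM _ fg) -cintegral_sum//.
apply: eq_cintegral => q _; rewrite -mulr_sumr; congr (_ * _).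
(* Linearity of [dot] in its second argument: the difference of the dot products at [(x, y)] and [q]
   is the dot product with their difference. *)
by apply: eq_bigr => theta _; congr Hkernel; rewrite /dot/=; ring.
Qed.
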